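(* Let $E$ be an edge of $G$ with initial vertex $V_1$ and terminal vertex $V_2$, where $V_1$ is a periodic point of $f$ with period $m$ and rotation element $w_1^{1/m}$ and $V_2$ is a periodic point of $f$ with period $n$ and rotation element $w_2^{1/n}$ (so $\widetilde f^m(\widetilde V_1)=w_1\widetilde V_1$ and $\widetilde f^n(\widetilde V_2)=w_2\widetilde V_2$), and $E$ belongs to the spanning tree used for the coherent labeling. Suppose $E$ belongs to both $w_1$ and $w_2$, and $w_1$ and $w_2$ are not powers of a common word (there are no $w\in\pi$ and integers $k_1,k_2$ with $w_1=w^{k_1}$ and $w_2=w^{k_2}$). Then there exist an initial word $\gamma_1$ of $w_1$ and an initial word $\gamma_2$ of $w_2$ such that for any rationals $r$ and $s$ satisfying $0<r<1/m$ and $0<s<1/n$ there exist integers $p,q,p',q'$ with $r=p/q$ and $s=p'/q'$ and periodic points of $f$ in $E$ with rotation elements $(w_1^p\gamma_1)^{1/q}$ and $(w_2^{p'}\gamma_2)^{1/q'}$.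
   Context: $G$ is a finite connected directed graph (multiple edges allowed, no looped edges) with base vertex $x_0$; $\pi=\pi_1(G,x_0)$, a free group; $\widetilde G$ is the universal cover of $G$, a tree. Elements of $\pi$ are identified with covering transformations of $\widetilde G$ (after fixing a lift $\widetilde x_0$ of $x_0$, the lift at $\widetilde x_0$ of a loop in class $\gamma$ ends at $\gamma\widetilde x_0$), and products act by $(\alpha\beta)\widetilde x=\alpha(\beta\widetilde x)$. Coherent labeling: choose a spanning tree $\mathcal T$ of $G$ rooted at $x_0$ and lift it to a tree in $\widetilde G$ through $\widetilde x_0$; this defines the chosen lifts $\widetilde V$ of all vertices and $\widetilde E$ of all edges of $\mathcal T$. For an edge $E\notin\mathcal T$ with initial vertex $V$ and terminal vertex $V'$, $\widetilde E$ is the lift of $E$ starting at $\widetilde V$; it ends at $\theta\widetilde V'$, where $\theta\in\pi$ is the class of the loop formed by $E$ and $\mathcal T$. These $\theta$ are free generators of $\pi$; words, and initial words (possibly empty initial subwords of the reduced word), are with respect to these generators. For $x$ in the interior of an edge $E$, $\widetilde x$ is the point of $\widetilde E$ over $x$; for a vertex, $\widetilde x$ is its chosen lift. The labeling is coherent with $E\in\mathcal T$, so $\widetilde E$ goes from $\widetilde V_1$ to $\widetilde V_2$. $f:G\to G$ is a continuous vertex map (it permutes the vertices of $G$) homotopic to the identity, and $\widetilde f$ is a fixed lift with $\widetilde f(\gamma\widetilde x)=\gamma\widetilde f(\widetilde x)$ for all $\gamma\in\pi$. Rotation element: for $x\in\mathrm{Fix}(f^n)$, let $w\in\pi$ satisfy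 $\widetilde f^n(\widetilde x)=w\widetilde x$; then $\rho(x)=w^{1/n}$. Rational powers are formal, modulo $(w^k)^r=w^{kr}$ for integers $k$ and rationals $r$ (equivalently they lie in the free $\mathbb Q$-group, where $w^{1/n}=v^{1/m}$ iff $w^m=v^n$). Belonging: an edge loop in $G$ is cyclically reduced when its first edge is not the reverse of its last edge (and it has no backtracking). Every loop can be contracted onto a cyclically reduced loop by changing the base point to another vertex of the loop and canceling adjacent inverse edges; the result is called a cyclic reduction. An edge $E$ belongs to $\alpha\in\pi$ when every cyclic reduction of $\alpha$ uses $E$ or $E^{-1}$. *)

(* Defs.v *)
From HB Require Import structures.
From mathcomp Require Import all_boot all_order all_algebra.
From mathcomp Require Import all_classical all_reals all_analysis.
Import numFieldNormedType.Exports.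
Set Implicit Arguments.
Unset Strict Implicit.
Unset Printing Implicit Defensive.
Import Order.TTheory GRing.Theory Num.Theory.
Local Open Scope classical_set_scope.
Local Open Scope ring_scope.

Record digraph := Digraph {
  vertex : choiceType;
  edge : choiceType;
  src : edge -> vertex;
  tgt : edge -> vertex }.

(* Vertices, together with the points [t] of the open edges; [0 < t < 1] is
   measured from the initial to the terminal vertex. *)
Inductive realization (R : realType) (D : digraph) :=
| VPoint of vertex D
| EPoint of edge D & {t : R | 0 < t < 1}.
Arguments VPoint R {D}.

(* The characteristic map [0, 1] -> |D| of a closed edge, extended to [R] by
   constants outside [0, 1]. *)
Definition edge_map (R : realType) (D : digraph) (e : edge D) (t : R) :
    realization R D :=
  if insub t is Some u then EPoint e u
  else VPoint R (if t <= 0 then src e else tgt e).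

Definition closed_edge (R : realType) (D : digraph) (e : edge D) :
    set (realization R D) :=
  [set edge_map e t | t in `[0, 1]%classic].

(* The weak (CW) topology.  Using [edge_map] on the whole of [R] does not change
   it, because [R] retracts onto [0, 1] by clamping. *)
Section Topology.
Variables (R : realType) (D : digraph).

HB.instance Definition _ := gen_eqMixin (realization R D).
HB.instance Definition _ := gen_choiceMixin (realization R D).

Definition open_point : set_system (realization R D) :=
  [set U | forall e : edge D, open ((@edge_map R D e) @^-1` U)].

Let open_pointT : open_point setT.
Proof. by move=> e; rewrite preimage_setT; exact: openT. Qed.

Let open_pointI : setI_closed open_point.
Proof. by move=> A B oA oB e; rewrite preimage_setI; exact: openI. Qed.

Let open_point_bigU (I : Type) (A : I -> set (realization R D)) :
  (forall i, open_point (A i)) -> open_point (\bigcup_i A i).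
Proof.
move=> oA e; rewrite preimage_bigcup; apply: bigcup_open => i _; exact: oA.
Qed.

HB.instance Definition _ :=
  isOpenTopological.Build (realization R D) open_pointT open_pointI open_point_bigU.
End Topology.

Definition homotopic (R : realType) (X Y : topologicalType) (f g : X -> Y) :=
  exists H : X * R -> Y,
    [/\ {within [set: X] `*` `[0, 1]%classic, continuous H},
        forall x, H (x, 0) = f x & forall x, H (x, 1) = g x].

Record finGraph := FinGraph {
  gvert : finType;
  gedge : finType;
  gsrc : gedge -> gvert;
  gtgt : gedge -> gvert;
  loopless : forall e, gsrc e != gtgt e }.

Coercion digraph_of (G : finGraph) : digraph := Digraph (@gsrc G) (@gtgt G).

(* [(e, true)] is the edge [e], [(e, false)] is the reversed edge. *)
Notation dart G := (gedge G * bool)%type.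

Section Walks.
Variable G : finGraph.
Implicit Types (d : dart G) (s : seq (dart G)) (v : gvert G).

Definition dsrc d := if d.2 then gsrc d.1 else gtgt d.1.
Definition dtgt d := if d.2 then gtgt d.1 else gsrc d.1.
Definition drev d : dart G := (d.1, ~~ d.2).

Definition connected_graph :=
  forall u v, connect [rel a b | [exists d, (dsrc d == a) && (dtgt d == b)]] u v.

Fixpoint walk v s : bool :=
  if s is d :: s' then (dsrc d == v) && walk (dtgt d) s' else true.
Definition wend v s : gvert G := last v (map dtgt s).
Definition reduced s : bool := sorted [rel d d' | d' != drev d] s.
Definition inv_walk s : seq (dart G) := rev (map drev s).

Definition push d s : seq (dart G) :=
  if s is d' :: s' then if d' == drev d then s' else d :: s else [:: d].

(* The reduced edge path obtained from [s] by canceling adjacent inverse edges. *)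
Definition reduce s : seq (dart G) := foldr push [::] s.

Lemma drevK : involutive drev.
Proof. by case=> e []. Qed.

Lemma dsrc_rev d : dsrc (drev d) = dtgt d.
Proof. by case: d => e []. Qed.

Lemma dtgt_rev d : dtgt (drev d) = dsrc d.
Proof. by case: d => e []. Qed.

Lemma drev_neq d : drev d != d.
Proof. by case: d => e []; rewrite /drev xpair_eqE eqxx. Qed.

Lemma walk_cat v s1 s2 : walk v (s1 ++ s2) = walk v s1 && walk (wend v s1) s2.
Proof.
elim: s1 v => [|d s1 IH] v //=.
by rewrite IH andbA.
Qed.

Lemma wend_cat v s1 s2 : wend v (s1 ++ s2) = wend (wend v s1) s2.
Proof. by rewrite /wend map_cat last_cat. Qed.

Lemma walk_push v d s : walk v (d :: s) -> walk v (push d s).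
Proof.
case: s => [|d' s] //=; case: (d' =P drev d) => [->|//].
by case/and3P=> /eqP <- _; rewrite dtgt_rev.
Qed.

Lemma wend_push v d s : walk v (d :: s) -> wend v (push d s) = wend v (d :: s).
Proof.
case: s => [|d' s] //=; case: (d' =P drev d) => [->|//].
by case/and3P=> /eqP <- _ _; rewrite /wend /= dtgt_rev.
Qed.

Lemma walk_reduce v s : walk v s -> walk v (reduce s).
Proof.
elim: s v => [|d s IH] v //= /andP[dv ws].
by apply: walk_push; rewrite /= dv IH.
Qed.

Lemma wend_reduce v s : walk v s -> wend v (reduce s) = wend v s.
Proof.
elim: s v => [|d s IH] v //= /andP[dv ws].
by rewrite wend_push /= ?dv ?walk_reduce //; exact: IH.
Qed.

Lemma reduced_cons d s : reduced (d :: s) -> reduced s.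
Proof. exact: path_sorted. Qed.

Lemma reduced_push d s : reduced s -> reduced (push d s).
Proof.
case: s => [|d' s] //= rs; case: eqP => [_|/eqP d'd]; first exact: path_sorted rs.
by rewrite /reduced /= d'd.
Qed.

Lemma reduced_reduce s : reduced (reduce s).
Proof. by elim: s => [|d s IH] //=; exact: reduced_push. Qed.

Lemma reduce_id s : reduced s -> reduce s = s.
Proof.
elim: s => [|d s IH] //= rds; rewrite IH ?(reduced_cons rds)//.
by case: s rds {IH} => [|d' s] //=; case/andP=> /negbTE ->.
Qed.

Lemma push_revK d s : reduced s -> push (drev d) (push d s) = s.
Proof.
case: s => [|d' s] /=; first by rewrite drevK eqxx.
case: eqP => [->|_] rs; last by rewrite /= drevK eqxx.
case: s rs => [|d'' s] //=; rewrite drevK => /andP[+ _].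
by move/negbTE ->.
Qed.

Lemma reduced_foldr_push s t : reduced t -> reduced (foldr push t s).
Proof. by move=> rt; elim: s => [|d s IH] //=; exact: reduced_push. Qed.

Lemma foldr_push_push d s t :
  reduced t -> foldr push t (push d s) = push d (foldr push t s).
Proof.
move=> rt; case: s => [|d' s] //=; case: (d' =P drev d) => [->|//].
by rewrite -{1}(drevK d) push_revK ?reduced_foldr_push.
Qed.

Lemma foldr_push_reduce s t :
  reduced t -> foldr push t (reduce s) = foldr push t s.
Proof. by move=> rt; elim: s => [|d s IH] //=; rewrite foldr_push_push// IH. Qed.

Lemma reduce_cat s1 s2 : reduce (s1 ++ s2) = foldr push (reduce s2) s1.
Proof. by rewrite /reduce foldr_cat. Qed.

Lemma reduce_catl s1 s2 : reduce (reduce s1 ++ s2) = reduce (s1 ++ s2).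
Proof. by rewrite !reduce_cat foldr_push_reduce ?reduced_reduce. Qed.

Lemma reduce_catr s1 s2 : reduce (s1 ++ reduce s2) = reduce (s1 ++ s2).
Proof. by rewrite !reduce_cat (reduce_id (reduced_reduce s2)). Qed.

Lemma reduce_catVs s : reduce (inv_walk s ++ s) = [::].
Proof.
elim: s => [|d s IH] //; rewrite /inv_walk /= rev_cons cat_rcons.
rewrite reduce_cat /= push_revK ?reduced_reduce// -reduce_cat; exact: IH.
Qed.

Lemma inv_walkK : involutive inv_walk.
Proof. by move=> s; rewrite /inv_walk map_rev revK mapK//; exact: drevK. Qed.

Lemma inv_walk_cons d s : inv_walk (d :: s) = inv_walk s ++ [:: drev d].
Proof. by rewrite /inv_walk /= rev_cons cats1. Qed.

Lemma wend_inv v s : walk v s -> wend (wend v s) (inv_walk s) = v.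
Proof.
case: s => [|d s] //= /andP[/eqP <- _].
by rewrite inv_walk_cons wend_cat /wend /= dtgt_rev.
Qed.

Lemma walk_inv v s : walk v s -> walk (wend v s) (inv_walk s).
Proof.
elim: s v => [|d s IH] v //= /andP[_ ws].
by rewrite -[wend v (d :: s)]/(wend (dtgt d) s) inv_walk_cons walk_cat IH//= wend_inv// dsrc_rev eqxx.
Qed.

End Walks.

Section Cover.
Variables (G : finGraph) (x0 : gvert G).

(* Homotopy classes of edge loops at [x0], represented by reduced edge loops. *)
Definition is_loop (s : seq (dart G)) := walk x0 s && (wend x0 s == x0).
Definition pi1 := {s : seq (dart G) | is_loop s && reduced s}.
HB.instance Definition _ := Choice.on pi1.

Lemma loop_class_subproof s : is_loop s -> is_loop (reduce s) && reduced (reduce s).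
Proof.
case/andP=> ws es.
by rewrite reduced_reduce /is_loop walk_reduce// wend_reduce// es.
Qed.

Definition loop_class s (ls : is_loop s) : pi1 :=
  exist _ (reduce s) (loop_class_subproof ls).

Lemma pi1_loop (a : pi1) : is_loop (sval a).
Proof. by case: a => s /= /andP[]. Qed.

Lemma is_loop_nil : is_loop [::].
Proof. by rewrite /is_loop /wend /= eqxx. Qed.

Lemma is_loop_cat s1 s2 : is_loop s1 -> is_loop s2 -> is_loop (s1 ++ s2).
Proof.
move=> /andP[w1 /eqP e1] /andP[w2 e2].
by rewrite /is_loop walk_cat wend_cat e1 w1 w2.
Qed.

Lemma is_loop_inv s : is_loop s -> is_loop (inv_walk s).
Proof.
case/andP=> ws /eqP es; have := walk_inv ws; have := wend_inv ws.
by rewrite /is_loop es => -> ->; rewrite eqxx.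
Qed.

Definition pi1_mul (a b : pi1) : pi1 :=
  loop_class (is_loop_cat (pi1_loop a) (pi1_loop b)).
Definition pi1_one : pi1 := loop_class is_loop_nil.
Definition pi1_inv (a : pi1) : pi1 := loop_class (is_loop_inv (pi1_loop a)).

Lemma pi1_mulA : associative pi1_mul.
Proof.
by move=> a b c; apply: val_inj; rewrite /= reduce_catr reduce_catl catA.
Qed.

Lemma pi1_mul1 : left_id pi1_one pi1_mul.
Proof.
by move=> a; apply: val_inj => /=; case/andP: (svalP a) => _; exact: reduce_id.
Qed.

Lemma pi1_mulr1 : right_id pi1_one pi1_mul.
Proof.
move=> a; apply: val_inj; rewrite /= cats0.
by case/andP: (svalP a) => _; exact: reduce_id.
Qed.

Lemma pi1_mulV : left_inverse pi1_one pi1_inv pi1_mul.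
Proof. by move=> a; apply: val_inj; rewrite /= reduce_catl reduce_catVs. Qed.

Lemma pi1_mulrV : right_inverse pi1_one pi1_inv pi1_mul.
Proof.
move=> a; apply: val_inj; rewrite /= reduce_catr -{1}(inv_walkK (sval a)).
exact: reduce_catVs.
Qed.

HB.instance Definition _ :=
  isGroup.Build pi1 pi1_mulA pi1_mul1 pi1_mulr1 pi1_mulV pi1_mulrV.

(* A vertex of the universal cover is a reduced edge path issued from [x0], and
   an edge is a lift [(w, e)] of [e] starting at the vertex [w]. *)
Definition cvert := {s : seq (dart G) | walk x0 s && reduced s}.
Definition cend (w : cvert) : gvert G := wend x0 (sval w).
Definition cedge := {we : cvert * gedge G | cend we.1 == gsrc we.2}.

Lemma cvert_subproof s : walk x0 s -> walk x0 (reduce s) && reduced (reduce s).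
Proof. by move=> ws; rewrite walk_reduce// reduced_reduce. Qed.

Definition path_class s (ws : walk x0 s) : cvert :=
  exist _ (reduce s) (cvert_subproof ws).

Lemma cvert_walk (w : cvert) : walk x0 (sval w).
Proof. by case: w => s /= /andP[]. Qed.

Lemma walk_extend (w : cvert) (e : gedge G) :
  cend w == gsrc e -> walk x0 (rcons (sval w) (e, true)).
Proof.
move=> /eqP ew; rewrite -cats1 walk_cat cvert_walk /=.
by rewrite /dsrc /= -ew eqxx.
Qed.

Definition csrc (a : cedge) : cvert := (sval a).1.
Definition ctgt (a : cedge) : cvert := path_class (walk_extend (svalP a)).
Definition ucover : digraph := Digraph csrc ctgt.

Lemma walk_act (g : pi1) (w : cvert) : walk x0 (sval g ++ sval w).
Proof.
case/andP: (pi1_loop g) => wg /eqP eg.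
by rewrite walk_cat wg eg cvert_walk.
Qed.

Definition act_vert (g : pi1) (w : cvert) : cvert := path_class (walk_act g w).

Lemma cend_act g w : cend (act_vert g w) = cend w.
Proof.
rewrite /cend /= wend_reduce ?walk_act// wend_cat.
by case/andP: (pi1_loop g) => _ /eqP ->.
Qed.

Lemma act_edge_subproof g (a : cedge) :
  cend (act_vert g (sval a).1) == gsrc (sval a).2.
Proof. by rewrite cend_act (svalP a). Qed.

Definition act_edge (g : pi1) (a : cedge) : cedge :=
  exist _ (act_vert g (sval a).1, (sval a).2) (act_edge_subproof g a).

Variable R : realType.

Definition cover_proj (y : realization R ucover) : realization R G :=
  match y with
  | VPoint w => @VPoint R G (cend w)
  | EPoint a t => @EPoint R G (sval a).2 t
  end.

Definition deck (g : pi1) (y : realization R ucover) : realization R ucover :=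
  match y with
  | VPoint w => @VPoint R ucover (act_vert g w)
  | EPoint a t => @EPoint R ucover (act_edge g a) t
  end.

Definition is_lift (f : realization R G -> realization R G)
    (ft : realization R ucover -> realization R ucover) :=
  continuous ft /\ forall y, cover_proj (ft y) = f (cover_proj y).

End Cover.

Definition vertex_map (R : realType) (G : finGraph)
    (f : realization R G -> realization R G) :=
  exists2 s : gvert G -> gvert G, bijective s &
    forall v, f (@VPoint R G v) = @VPoint R G (s v).

Section Labeling.
Variables (G : finGraph) (x0 : gvert G) (T : {set gedge G}).

Definition in_tree (s : seq (dart G)) := all (fun d : dart G => d.1 \in T) s.

Record spanning_tree : Prop := SpanningTree {
  tree_acyclic : forall v s,
    walk v s -> reduced s -> in_tree s -> wend v s = v -> s = [::];
  tree_spans : forall v,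
    exists w : cvert x0, (cend w == v) && in_tree (sval w) }.

Hypothesis hT : spanning_tree.

(* The path in the tree from [x0] to [v], i.e., the lift of [v] lying in the lift
   of the tree through the base point (the empty path) of the cover. *)
Definition lift_vert (v : gvert G) : cvert x0 := xchoose (tree_spans hT v).

Lemma cend_lift v : cend (lift_vert v) = v.
Proof. by case/andP: (xchooseP (tree_spans hT v)) => /eqP. Qed.

Lemma lift_edge_subproof e : cend (lift_vert (gsrc e)) == gsrc e.
Proof. by rewrite cend_lift. Qed.

(* If [e] is in the tree, the lift of [e] starting at the chosen lift of its
   initial vertex is the one contained in the lifted tree. *)
Definition lift_edge (e : gedge G) : cedge x0 :=
  exist _ (lift_vert (gsrc e), e) (lift_edge_subproof e).

Definition lift_point (R : realType) (x : realization R G) :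
    realization R (ucover x0) :=
  match x with
  | VPoint v => @VPoint R (ucover x0) (lift_vert v)
  | EPoint e t => @EPoint R (ucover x0) (lift_edge e) t
  end.

Lemma theta_subproof e :
  is_loop x0 (sval (lift_vert (gsrc e)) ++
    (e, true) :: inv_walk (sval (lift_vert (gtgt e)))).
Proof.
have ws := cvert_walk (lift_vert (gsrc e)).
have wt := cvert_walk (lift_vert (gtgt e)).
have := walk_inv wt; have := wend_inv wt.
rewrite -!/(cend _) !cend_lift => et wit.
rewrite /is_loop walk_cat wend_cat ws -/(cend _) cend_lift /=.
by rewrite /dsrc /= eqxx wit /wend /= -/(wend _ _) et eqxx.
Qed.

Definition theta (e : gedge G) : pi1 x0 := loop_class (theta_subproof e).

(* A letter [(e, b)], with [e] outside the tree, is [theta e] or its inverse; the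
   words are thus encoded by sequences of darts, and [reduced] says that no
   letter is followed by its inverse. *)
Definition letter (d : dart G) : pi1 x0 :=
  if d.2 then theta d.1 else ((theta d.1)^-1)%g.
Definition word_value (u : seq (dart G)) : pi1 x0 := (\prod_(d <- u) letter d)%g.
Definition is_reduced_word (u : seq (dart G)) :=
  all (fun d : dart G => d.1 \notin T) u && reduced u.

Definition initial_word (g w : pi1 x0) :=
  exists u v : seq (dart G),
    [/\ is_reduced_word u, word_value u = w, prefix v u & word_value v = g].

End Labeling.

Section Belonging.
Variables (G : finGraph) (x0 : gvert G).
Implicit Types s t : seq (dart G).

(* A closed edge path is changed by moving its base point and by canceling
   adjacent inverse edges. *)
Inductive contracts_to : seq (dart G) -> seq (dart G) -> Prop :=
| contracts_refl s : contracts_to s s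
| contracts_rot k s t : contracts_to (rot k s) t -> contracts_to s t
| contracts_cancel s1 d s2 t :
    contracts_to (s1 ++ s2) t -> contracts_to (s1 ++ [:: d, drev d & s2]) t.

Definition cyclically_reduced s :=
  reduced s && (if s is d :: s' then d != drev (last d s') else true).

Definition cyclic_reduction (a : pi1 x0) t :=
  exists s (ls : is_loop x0 s),
    [/\ loop_class ls = a, contracts_to s t & cyclically_reduced t].

Definition belongs (e : gedge G) (a : pi1 x0) :=
  forall t, cyclic_reduction a t -> e \in map fst t.

End Belonging.

Definition zpow (gT : groupType) (x : gT) (k : int) : gT :=
  match k with Posz n => (x ^+ n)%g | Negz n => ((x ^+ n.+1)^-1)%g end.

(* The pair [(w, q)], with [0 < q], stands for the formal power w^(1/q); in the
   free Q-group, w^(1/n) = v^(1/m) iff w^m = v^n. *)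
Definition root_eq (gT : groupType) (a b : gT * int) :=
  zpow a.1 b.2 = zpow b.1 a.2.

Section Rotation.
Variables (R : realType) (G : finGraph) (x0 : gvert G) (T : {set gedge G}).
Variable hT : spanning_tree x0 T.
Variable f : realization R G -> realization R G.
Variable ft : realization R (ucover x0) -> realization R (ucover x0).

(* [x] is a fixed point of the [n]-th iterate, with rotation element w^(1/n)
   obtained from this [n]. *)
Definition rotates (x : realization R G) (n : nat) (w : pi1 x0) :=
  [/\ (0 < n)%N, iter n f x = x &
      iter n ft (lift_point hT x) = deck w (lift_point hT x)].

Definition periodic_with_rotation (x : realization R G) (a : pi1 x0 * int) :=
  exists n u, rotates x n u /\ root_eq (u, n%:Z) a.

End Rotation.

(* Main.v *)
(** Let [E~] be the lift of [E] in the lifted tree. An iterate [ft^N], with [N] a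
   common multiple of [m] and [n], maps the ends of [E~] to [w1^K V1~] and
   [w2^L V2~], where [K = N/m] and [L = N/n]. Since [E] belongs to [w1], a
   translate [g E~] lies on the axis of [w1], with [g] an initial word of [w1], and
   [w1^p g E~] separates [V1~] from [w1^K V1~] when [p] and [K - p] are large. It
   does not separate [V2~] from any [w2^L V2~] when [p] is large: otherwise
   infinitely many [w1^p g E~] would lie in the [w2]-orbit of a finite set of edges,
   and two of them with the same representative would give [w1^i = w2^j] with
   [i > 0], hence a common root. So [w1^p g E~] separates [w1^K V1~] from
   [w2^L V2~], [ft^N] maps [E~] across it, and the intermediate value theorem gives
   [x] in [E~] with [ft^N x = w1^p g x]. For [r = p/N] fixed in ]0, 1/m[, both [p]
   and [K - p] are large as soon as [N] is. *)
From HB Require Import structures.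
Require Import Defs.
From mathcomp Require Import all_boot all_order all_algebra.
From mathcomp Require Import all_classical all_reals all_analysis.
From mathcomp Require Import zify lra.
Import Order.TTheory GRing.Theory Num.Theory.
Import numFieldNormedType.Exports.
Set Implicit Arguments.
Unset Strict Implicit.
Unset Printing Implicit Defensive.
Local Open Scope classical_set_scope.
Local Open Scope ring_scope.

(** * Words, cyclic cores and roots *)

Section Powers.
Variable T : eqType.
Implicit Types c d s : seq T.

Lemma cat_eq_size_le c d s1 s2 :
  c ++ s1 = d ++ s2 -> (size c <= size d)%N -> exists s, d = c ++ s.
Proof.
move=> E le; exists (drop (size c) d).
have := congr1 (take (size c)) E; rewrite take_size_cat// take_cat.
case: ltnP => [_ Ec|ge]; first by rewrite {1}Ec cat_take_drop.
have /eqP eqs : size c == size d by rewrite eqn_leq le.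
by rewrite eqs subnn take0 cats0 drop_size cats0 => ->.
Qed.

Lemma nseq_cat_comm n c : c ++ flatten (nseq n c) = flatten (nseq n c) ++ c.
Proof. by elim: n => [|n IH] /=; rewrite ?cats0// {1}IH catA. Qed.

Lemma flatten_nseqD i j c :
  flatten (nseq (i + j) c) = flatten (nseq i c) ++ flatten (nseq j c).
Proof. by rewrite nseqD flatten_cat. Qed.

(** Euclid's algorithm on words: the shorter word is a prefix of the longer one, and the remainder
    still commutes with it, so induction on the total length applies. *)
Lemma cat_comm_powers c d : c ++ d = d ++ c ->
  exists s a b, c = flatten (nseq a s) /\ d = flatten (nseq b s).
Proof.
have [k] := ubnP (size c + size d).
elim: k c d => [|k IH] c d; first by rewrite ltn0.
wlog le : c d / (size c <= size d)%N => [W sk E|].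
  case: (leqP (size c) (size d)) => le; first exact: W.
  have [|s [a [b [? ?]]]] := W d c (ltnW le) _ (esym E); first by rewrite addnC.
  by exists s, b, a.
case: c le => [|x c] le; first by move=> _ _; exists d, 0%N, 1%N; rewrite /= cats0.
move=> sk E; have [d' Ed] := cat_eq_size_le E le.
have [||s [a [b [E1 E2]]]] := IH (x :: c) d'.
- by move: sk; rewrite Ed size_cat /=; lia.
- by move: E; rewrite Ed -catA => /(congr1 (drop (size (x :: c)))); rewrite !drop_size_cat.
by exists s, a, (a + b)%N; rewrite flatten_nseqD -E1 -E2.
Qed.

(* [c] and [d] commute, as [cd] and [dc] are both prefixes of [WW], where [W] is the
   common power. *)
Lemma flatten_nseq_powers i j c d :
  flatten (nseq i.+1 c) = flatten (nseq j.+1 d) ->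
  exists s a b, c = flatten (nseq a s) /\ d = flatten (nseq b s).
Proof.
move=> E; apply: cat_comm_powers.
set W := flatten (nseq i.+1 c) in E.
have cW : c ++ W = W ++ c := nseq_cat_comm i.+1 c.
have dW : d ++ W = W ++ d by rewrite E; exact: (nseq_cat_comm j.+1 d).
have leW : (size c + size d <= size (W ++ W))%N.
  by rewrite size_cat {2}E /= !size_cat; lia.
have tk x : x ++ W = W ++ x ->
    take (size c + size d) (x ++ W ++ W) = take (size c + size d) (W ++ W).
  by move=> xW; rewrite catA xW -catA xW catA takel_cat.
have := etrans (tk c cW) (esym (tk d dW)).
have -> : c ++ W ++ W = c ++ d ++ flatten (nseq j d) ++ W by rewrite {1}E /= !catA.
have -> : d ++ W ++ W = d ++ c ++ flatten (nseq i c) ++ W by rewrite {1}/W /= !catA.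
by rewrite !catA -!(catA (_ ++ _)) !take_size_cat ?size_cat// addnC.
Qed.
End Powers.

(** * Reduced edge paths and their cyclic cores *)

Section ReducedPaths.
Variable G : finGraph.
Implicit Types (d : dart G) (c s t : seq (dart G)).

Lemma reduced_catl s t : reduced (s ++ t) -> reduced s.
Proof. by move/cat_sorted2 => []. Qed.

Lemma reduced_catr s t : reduced (s ++ t) -> reduced t.
Proof. by move/cat_sorted2 => []. Qed.

Lemma reduced_cat_cons s a b t :
  reduced (rcons s a ++ b :: t) =
  [&& reduced (rcons s a), b != drev a & reduced (b :: t)].
Proof.
rewrite /reduced; case: s => [|x s] //=.
by rewrite cat_path last_rcons.
Qed.

(** Reducedness only involves adjacent letters, and the nonempty [c] keeps [s] and [t] from
    touching. *)
Lemma reduced_glue s c t : c != [::] ->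
  reduced (s ++ c) -> reduced (c ++ t) -> reduced (s ++ c ++ t).
Proof.
case: c => // x c _; case/lastP: s => [|s a] //.
by rewrite cat_cons !reduced_cat_cons => /and3P[-> -> _].
Qed.

Lemma reduced_glue_nseq n s c t : c != [::] -> reduced (c ++ c) ->
  reduced (s ++ c) -> reduced (c ++ t) ->
  reduced (s ++ flatten (nseq n.+1 c) ++ t).
Proof.
move=> c0 rcc; elim: n s => [|n IH] s rs rt.
  by rewrite /= cats0 reduced_glue.
by rewrite [nseq _ _]/= [flatten _]/= -catA; apply: reduced_glue => //; exact: IH.
Qed.

Lemma inv_walk_cat s t : inv_walk (s ++ t) = inv_walk t ++ inv_walk s.
Proof. by rewrite /inv_walk map_cat rev_cat. Qed.

Lemma reduced_inv s : reduced (inv_walk s) = reduced s.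
Proof.
suff W t : reduced t -> reduced (inv_walk t).
  by apply/idP/idP; [rewrite -{2}(inv_walkK s)|]; exact: W.
elim: t => [|d [|d' t] IH] // rt; rewrite inv_walk_cons.
move: (IH (reduced_cons rt)); rewrite inv_walk_cons cats1 => r1.
rewrite reduced_cat_cons r1 /= andbT drevK.
by case/andP: rt => + _; rewrite eq_sym.
Qed.

Lemma cyclically_reduced_cat c : cyclically_reduced c -> reduced (c ++ c).
Proof.
case: c => [|b c] // /andP[]; case/lastP: c => [|c a] r ba.
  by rewrite /= in ba; rewrite /reduced /= ba.
rewrite last_rcons in ba; rewrite -rcons_cons {2}rcons_cons reduced_cat_cons.
by rewrite rcons_cons ba r.
Qed.

(** As long as the first and last letters are mutually inverse, they are moved into the conjugator
    [t]. *)
Lemma cyclic_core s : reduced s ->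
  exists t c, s = t ++ c ++ inv_walk t /\ cyclically_reduced c.
Proof.
have [k] := ubnP (size s); elim: k s => // k IH [|d s] sk r.
  by exists [::], [::].
have [ds|] := boolP (d != drev (last d s)).
  by exists [::], (d :: s); rewrite cats0 /cyclically_reduced r.
rewrite negbK; case/lastP: s sk r => [|s a] sk r.
  by rewrite /= eq_sym (negbTE (drev_neq _)).
rewrite last_rcons => /eqP da.
have [||t [c [Es cc]]] := IH s.
- by move: sk; rewrite /= size_rcons; lia.
- by move: (reduced_cons r); rewrite -cats1; exact: reduced_catl.
exists (d :: t), c; split => //.
by rewrite inv_walk_cons da drevK Es -cats1 !catA -!catA.
Qed.

(** Rotating the last letter to the front puts it next to its inverse; canceling the two removes one
    layer of the conjugator. *)
Lemma contracts_core t c : contracts_to (t ++ c ++ inv_walk t) c.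
Proof.
elim: t => [|d t IH]; first by rewrite cats0; exact: contracts_refl.
rewrite inv_walk_cons.
have -> : (d :: t) ++ c ++ inv_walk t ++ [:: drev d] =
  (d :: t ++ c ++ inv_walk t) ++ [:: drev d] by rewrite /= -!catA.
apply: (contracts_rot (k := size (d :: t ++ c ++ inv_walk t))).
rewrite rot_size_cat /=.
by have := @contracts_cancel G [::] (drev d) _ _ IH; rewrite drevK.
Qed.

(** If [t' = t u], then [c = u c' u^-1]; a nonempty [u] would make the last letter of [c] the
    inverse of its first. *)
Lemma core_unique t t' c c' : c != [::] -> c' != [::] ->
  cyclically_reduced c -> cyclically_reduced c' ->
  t ++ c ++ inv_walk t = t' ++ c' ++ inv_walk t' -> c = c'.
Proof.
wlog le : t t' c c' / (size t <= size t')%N => [W c0 c'0 cc cc' E|].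
  case: (leqP (size t) (size t')) => le; first exact: (W t t').
  by apply/esym; apply: (W t' t) => //; exact: ltnW.
move=> c0 c'0 cc cc' E.
have [u Et'] := cat_eq_size_le E le.
move: E; rewrite Et' inv_walk_cat -!catA => /(congr1 (drop (size t))).
rewrite !drop_size_cat// !catA => /(congr1 (rev)); rewrite !rev_cat.
move=> /(congr1 (drop (size (rev (inv_walk t))))); rewrite !drop_size_cat//.
rewrite -!rev_cat => /(congr1 rev); rewrite !revK.
case: u {Et' le} => [|x u] Ec; first by move: Ec; rewrite /inv_walk /= cats0.
exfalso; move: cc; rewrite Ec inv_walk_cons /cyclically_reduced /=.
by rewrite catA last_cat /= drevK eqxx andbF.
Qed.
End ReducedPaths.

(** * Powers and roots in the free group on the edges *)

Section FreeGroup.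
Variable G : finGraph.
Implicit Types (d : dart G) (c s t : seq (dart G)).

(* The free group on the edges: both [pi1] and the vertices of the universal
   cover embed in it, the deck action becoming left multiplication. *)
Definition edge_group := {s : seq (dart G) | reduced s}.
HB.instance Definition _ := Choice.on edge_group.

Definition eclass s : edge_group := exist _ (reduce s) (reduced_reduce s).

Lemma eclass_val (x : edge_group) : eclass (val x) = x.
Proof. by apply: val_inj; rewrite /= reduce_id//; case: x. Qed.

Definition edge_mul (x y : edge_group) := eclass (val x ++ val y).

Lemma edge_mulA : associative edge_mul.
Proof. by move=> a b c; apply: val_inj; rewrite /= reduce_catr reduce_catl catA. Qed.

Lemma edge_mul1 : left_id (eclass [::]) edge_mul.
Proof. by move=> x; rewrite /edge_mul /= eclass_val. Qed.

Lemma edge_mulr1 : right_id (eclass [::]) edge_mul.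
Proof. by move=> x; rewrite /edge_mul cats0 eclass_val. Qed.

Lemma edge_mulV : left_inverse (eclass [::]) (fun x => eclass (inv_walk (val x))) edge_mul.
Proof. by move=> x; apply: val_inj; rewrite /= reduce_catl reduce_catVs. Qed.

Lemma edge_mulrV : right_inverse (eclass [::]) (fun x => eclass (inv_walk (val x))) edge_mul.
Proof.
move=> x; apply: val_inj; rewrite /= reduce_catr -{1}(inv_walkK (val x)).
exact: reduce_catVs.
Qed.

HB.instance Definition _ :=
  isGroup.Build edge_group edge_mulA edge_mul1 edge_mulr1 edge_mulV edge_mulrV.

Lemma eclass_cat s t : eclass (s ++ t) = (eclass s * eclass t)%g.
Proof. by apply: val_inj; rewrite /= reduce_catl reduce_catr. Qed.

Lemma eclass_inv s : eclass (inv_walk s) = ((eclass s)^-1)%g.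
Proof.
apply/esym/mulg1_eq; rewrite -eclass_cat; apply: val_inj => /=.
by rewrite -{1}(inv_walkK s) reduce_catVs.
Qed.

Lemma eclass_nseq n c : eclass (flatten (nseq n c)) = (eclass c ^+ n)%g.
Proof. by elim: n => [|n IH] //=; rewrite eclass_cat IH expgS. Qed.

Lemma val_eclass s : reduced s -> val (eclass s) = s.
Proof. exact: reduce_id. Qed.

(** The conjugators cancel between consecutive factors, and copies of a cyclically reduced core
    concatenate without cancellation. *)
Lemma cyclic_core_expg (x : edge_group) : x != 1%g ->
  exists t c, [/\ val x = t ++ c ++ inv_walk t, cyclically_reduced c, c != [::] &
    forall n, val (x ^+ n.+1)%g = t ++ flatten (nseq n.+1 c) ++ inv_walk t].
Proof.
move=> x1; have rx := valP x; have [t [c [Ex cc]]] := cyclic_core rx.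
have Et : x = (eclass t * eclass c * eclass (inv_walk t))%g.
  by rewrite -!eclass_cat -catA -Ex eclass_val.
have c0 : c != [::].
  apply: contraNneq x1 => c0; rewrite Et c0 eclass_inv.
  by rewrite -[eclass [::]]/(1%g : edge_group) mulg1 mulgV.
exists t, c; split => // n.
have -> : (x ^+ n.+1)%g = eclass (t ++ flatten (nseq n.+1 c) ++ inv_walk t).
  rewrite eclass_cat [eclass (_ ++ inv_walk t)]eclass_cat eclass_nseq Et eclass_inv.
  elim: n => [|n IH]; first by rewrite !expg1 mulgA.
  by rewrite expgS IH [in RHS]expgS !mulgA mulgVK.
apply: val_eclass; move: rx; rewrite Ex => rx.
apply: reduced_glue_nseq => //; first exact: cyclically_reduced_cat.
- by move: rx; rewrite catA; exact: reduced_catl.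
- exact: reduced_catr rx.
Qed.

Lemma expg_neq1 (x : edge_group) i : x != 1%g -> (x ^+ i.+1 != 1)%g.
Proof.
case/cyclic_core_expg => t [c [_ _ c0 Xn]]; apply/eqP => /(congr1 val).
by rewrite Xn; case: c c0 {Xn} => // d c _; case: t.
Qed.

(** Both sides have the same cyclic core, so a power of [c] equals a power of [c'] as words, and
    both are powers of one word [s]. The conjugators agree too, and the root is [t s t^-1]. *)
Lemma expg_eq_root (x y : edge_group) i j : x != 1%g -> y != 1%g ->
  (x ^+ i.+1 = y ^+ j.+1)%g -> exists z a b, x = (z ^+ a)%g /\ y = (z ^+ b)%g.
Proof.
move=> /cyclic_core_expg[t [c [Ex cc c0 Xn]]] /cyclic_core_expg[t' [c' [Ey cc' c'0 Yn]]] E.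
have cyc n s : s != [::] -> cyclically_reduced s -> cyclically_reduced (flatten (nseq n.+1 s)).
  move=> s0 cs; rewrite /cyclically_reduced.
  have /andP[rs _] := cs.
  have := @reduced_glue_nseq _ n [::] s [::] s0 (cyclically_reduced_cat cs) rs.
  rewrite cats0 /= cats0 => -> //=.
  case: s s0 cs {rs} => // d s _ /andP[_ ds] /=.
  rewrite last_cat; elim: n => [|n IH] //=.
  by rewrite last_cat.
have ne n s : s != [::] -> flatten (nseq n.+1 s) != [::] by case: s.
have Ec : flatten (nseq i.+1 c) = flatten (nseq j.+1 c').
  by apply: (@core_unique _ t t'); rewrite ?ne ?cyc// -Xn -Yn E.
(* The cores being equal, the total lengths force the conjugators to have the same length. *)
have Et : t = t'.
  move/(congr1 val): E; rewrite Xn Yn -Ec => E.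
  have st : size t = size t'.
    by move/(congr1 size): E; rewrite !size_cat /inv_walk !size_rev !size_map; lia.
  by move/(congr1 (take (size t))): E; rewrite take_size_cat// st take_size_cat.
have [s [a [b [Ea Eb]]]] := flatten_nseq_powers Ec.
exists (eclass t * eclass s * (eclass t)^-1)%g, a, b.
have conj n : ((eclass t * eclass s * (eclass t)^-1) ^+ n =
    eclass t * eclass s ^+ n * (eclass t)^-1)%g.
  elim: n => [|n IH]; first by rewrite !expg0 mulg1 mulgV.
  by rewrite expgS IH expgS !mulgA mulgVK.
rewrite !conj -!eclass_nseq -Ea -Eb -eclass_inv -!eclass_cat -!catA.
by rewrite -Ex {1}Et [in inv_walk t]Et -Ey !eclass_val.
Qed.
End FreeGroup.

(** * Edges separating vertices of the Cayley tree *)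

(** Each element of [F] occurs at one index at most. [P] is a relation so that it can also describe
    membership in a whole orbit. *)
Lemma eventually_notin (T : eqType) (P : nat -> T -> Prop) (F : seq T) :
  (forall i j z, P i z -> P j z -> i = j) ->
  exists C : nat, forall i z, (C <= i)%N -> P i z -> z \notin F.
Proof.
move=> injP; elim: F => [|x F [C HC]]; first by exists 0%N.
have [[i Pi]|nP] := pselect (exists i, P i x).
  exists (maxn C i.+1) => j z; rewrite geq_max => /andP[Cj ij] Pz.
  rewrite inE negb_or (HC j z)// andbT; apply/eqP => zx; subst z.
  by move: ij; rewrite (injP _ _ _ Pz Pi) ltnn.
exists C => j z Cj Pz; rewrite inE negb_or (HC j z)// andbT.
by apply/eqP => zx; apply: nP; exists j; rewrite -zx.
Qed.

Section Sides.
Variable G : finGraph.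
Implicit Types (e : gedge G) (d : dart G) (s t : seq (dart G)).
Implicit Types k u v x y : edge_group G.
Local Open Scope group_scope.

(* In the Cayley tree of the free group, the edge from [k] to [k * e] cuts off
   the [v] such that the reduced word of [k^-1 * v] starts with the letter [e]. *)
Definition side e k v : bool := ohead (val (k^-1 * v)) == Some (e, true).

Lemma side_act e g k v : side e (g * k) (g * v) = side e k v.
Proof. by rewrite /side invgM -mulgA mulKg. Qed.

Lemma eclass_reduce s : eclass (reduce s) = eclass s.
Proof. by apply: val_inj => /=; rewrite reduce_id// reduced_reduce. Qed.

(** Right multiplication by a letter changes the first letter of a reduced word only if the word is
    empty before or after it. *)
Lemma side_step e k v d : side e k v != side e k (v * eclass [:: d]) ->
  d.1 = e /\ (if d.2 then v else v * eclass [:: d]) = k.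
Proof.
rewrite /side mulgA; set z := k^-1 * v => H.
have Ev : v = k * z by rewrite mulVKg.
suff [-> Ez] : d.1 = e /\ (if d.2 then z else z * eclass [:: d]) = 1.
  by split=> //; rewrite Ev -mulgA; case: d.2 Ez => ->; rewrite mulg1.
clearbody z => {Ev}.
move: H; rewrite -(eclass_val z); have : reduced (val z) := valP z.
case/lastP: (val z) => [|s l] r.
  rewrite -eclass_cat cat0s !val_eclass//= eq_sym eqbF_neg negbK.
  by move=> /eqP[->].
have [dl|dl] := eqVneq d (drev l).
  have -> : eclass (rcons s l) * eclass [:: d] = eclass s.
    rewrite -eclass_cat cat_rcons dl eclass_cat.
    have -> : eclass [:: l; drev l] = 1 by apply: val_inj; rewrite /= eqxx.
    by rewrite mulg1.
  have rs : reduced s by move: r; rewrite -cats1; exact: reduced_catl.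
  rewrite !val_eclass//; case: s {r rs} => [|a s] /=; last by rewrite eqxx.
  by rewrite -[None == _]/false eqbF_neg negbK => /eqP[le]; rewrite dl le.
rewrite -eclass_cat cats1 !val_eclass//; last first.
  by rewrite -cats1 reduced_cat_cons r dl.
by case: s {r} => [|a s] /=; rewrite eqxx.
Qed.

(** A separating edge must be one of those on the path from [u] to [v]. Both ends of each step are
    listed, since its orientation decides which of them is the initial vertex. *)
Lemma separators_finite e u v :
  exists F : seq (edge_group G), forall k, side e k u != side e k v -> k \in F.
Proof.
rewrite -[v](mulVKg u) -(eclass_val (u^-1 * v)).
move: (val _) => s; elim: s u => [|d s IH] u.
  by exists [::] => k; rewrite -[eclass _]/(1 : edge_group G) mulg1 eqxx.
have [F HF] := IH (u * eclass [:: d]).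
exists (u :: u * eclass [:: d] :: F) => k.
rewrite -cat1s eclass_cat mulgA.
have [E|/side_step[_ <-] _] := eqVneq (side e k u) (side e k (u * eclass [:: d])).
  by rewrite E => /HF kF; rewrite !inE kF !orbT.
by case: d.2; rewrite !inE eqxx ?orbT.
Qed.

(** A reduced path never returns across an edge. [k] is the initial vertex of the edge traversed by
    [d]: the end of [A], or of [A d] if [d] is reversed. *)
Lemma reduced_separates A d B (k := eclass (if d.2 then A else rcons A d)) :
  reduced (A ++ d :: B) -> side d.1 k 1 != side d.1 k (eclass (A ++ d :: B)).
Proof.
move=> r; have rB := reduced_catr r.
have rA : reduced (rcons A d) by move: r; rewrite -cat_rcons; exact: reduced_catl.
have rA' : reduced A by move: rA; rewrite -cats1; exact: reduced_catl.
rewrite {}/k; case: d r rB rA => e [] r rB rA.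
  suff: side e (eclass A) 1 != side e (eclass A) (eclass (A ++ (e, true) :: B)) by [].
  rewrite /side mulg1 eclass_cat mulKg -eclass_inv !val_eclass ?reduced_inv// [ohead (_ :: _)]/=.
  rewrite eqxx eqb_id; apply/negP => H.
  case/lastP: A rA {r rA'} H => [|A a] //.
  rewrite -cats1 reduced_cat_cons -cats1 inv_walk_cat /= => /and3P[_ + _] /eqP/Some_inj ae.
  by rewrite ae eqxx.
(* For a reversed [d], the start of the path lies beyond the edge and its end does not. *)
have rB' := reduced_cons rB.
set k := eclass (rcons A (e, false)).
suff: side e k 1 != side e k (eclass (A ++ (e, false) :: B)) by [].
rewrite /side mulg1 /k -cat_rcons eclass_cat mulKg -eclass_inv !val_eclass ?reduced_inv//.
rewrite -cats1 inv_walk_cat [ohead (_ ++ _)]/= eqxx.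
rewrite eq_sym eqb_id; case: B rB {r rB' k} => // b B /andP[be _].
by apply: contraNneq be => -[->].
Qed.

(** The path from [t] to [x^K t] reads the reduced word [c^K]; the edge at [x^p k] is the letter [d]
    in its copy number [p] of [c], counted from 0. *)
Lemma axis_separates x t c1 d c2
    (k := eclass (if d.2 then t ++ c1 else rcons (t ++ c1) d)) p K :
  val x = t ++ (c1 ++ d :: c2) ++ inv_walk t ->
  cyclically_reduced (c1 ++ d :: c2) -> (p < K)%N ->
  side d.1 (x ^+ p * k) (eclass t) != side d.1 (x ^+ p * k) (x ^+ K * eclass t).
Proof.
set c := c1 ++ _ => Ex cc pK.
have c0 : c != [::] by rewrite /c; case: c1 {k Ex cc} @c.
have xt n : x ^+ n * eclass t = eclass t * eclass (flatten (nseq n c)).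
  rewrite eclass_nseq; elim: n => [|n IH]; first by rewrite !expg0 mul1g mulg1.
  rewrite expgS -mulgA IH mulgA -(eclass_val x) Ex catA eclass_cat eclass_inv.
  by rewrite mulgVK eclass_cat -mulgA -expgS.
pose A := flatten (nseq p c) ++ c1; pose B := c2 ++ flatten (nseq (K - p.+1) c).
have EAB : flatten (nseq K c) = A ++ d :: B.
  by rewrite -{1}(subnKC pK) addSnnS flatten_nseqD /A /B [nseq _.+1 _]/= /= /c -!catA.
have -> : x ^+ p * k = eclass t * eclass (if d.2 then A else rcons A d).
  have -> : k = eclass t * eclass (if d.2 then c1 else rcons c1 d).
    by rewrite -eclass_cat /k; case: d.2 => //; rewrite rcons_cat.
  rewrite mulgA xt -mulgA /A.
  by case: d.2; rewrite ?rcons_cat (eclass_cat (flatten _)).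
rewrite xt -{2}[eclass t]mulg1 !side_act EAB; apply: reduced_separates.
rewrite -EAB; case: K pK {EAB B} => // K _.
rewrite -[flatten _]cats0; apply: (@reduced_glue_nseq _ _ [::]) => //.
- exact: cyclically_reduced_cat.
- by case/andP: cc.
- by rewrite cats0; case/andP: cc.
Qed.

(* [o] is a vertex on the axis of [x]. *)
Lemma axis_edge_separates e x y k o u v :
  (forall i j, (0 < i)%N -> x ^+ i != y ^+ j /\ x ^+ i != y ^- j) ->
  (forall p K, (p < K)%N ->
    side e (x ^+ p * k) o != side e (x ^+ p * k) (x ^+ K * o)) ->
  exists C : nat, forall p K L, (C <= p)%N -> (C + p <= K)%N ->
    side e (x ^+ p * k) (x ^+ K * u) != side e (x ^+ p * k) (y ^+ L * v).
Proof.
move=> xy axis.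
have xinj i j : x ^+ i = x ^+ j -> i = j.
  wlog le : i j / (i <= j)%N => [W E|].
    by case: (leqP i j) => le; [exact: W|apply/esym; apply: W (ltnW le) (esym E)].
  move=> E; apply/eqP; rewrite eqn_leq le leqNgt; apply/negP => lt.
  have [|/eqP xji _] := xy (j - i)%N 0%N; first by rewrite subn_gt0.
  apply: xji.
  by apply: (@mulgI _ (x ^+ i)); rewrite -expgnDr subnKC// mulg1 -E.
have eq_side (F : seq (edge_group G)) u1 u2 z : (forall k, side e k u1 != side e k u2 -> k \in F) ->
    z \notin F -> side e z u1 = side e z u2.
  by move=> HF; case: (eqVneq (side e z u1) (side e z u2)) => // /HF ->.
(* The route from [x^K u] to [y^L v] goes through [x^K o], [o] and [v]. Outside translates of [F1],
   [F2] and [F3], an edge can only separate [x^K o] from [o]. *)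
have [F1 H1] := separators_finite e u o.
have [F2 H2] := separators_finite e o v.
have [F3 H3] := separators_finite e v (y * v).
have [|C1 B1] := @eventually_notin (edge_group G) (fun n z => z = x ^- n * k) F1.
  by move=> i j z -> /mulIg/invg_inj/xinj.
have [|C2 B2] := @eventually_notin (edge_group G) (fun n z => z = x ^+ n * k) F2.
  by move=> i j z -> /mulIg/xinj.
(* An element lies in the [y]-orbit of [x^n k] for one [n] at most: two would make a positive power
   of [x] a power of [y]. *)
have [|C3 B3] := @eventually_notin (edge_group G)
    (fun n z => exists j : nat, z = y ^- j * (x ^+ n * k)) F3.
  move=> i i' z [j ->] [j']; rewrite !mulgA => /mulIg.
  wlog le : i i' j j' / (i <= i')%N => [W E|].
    by case: (leqP i i') => le; [exact: W E|apply/esym; exact: W (ltnW le) (esym E)].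
  move=> E; apply/eqP; rewrite eqn_leq le leqNgt; apply/negP => lt.
  have Ex : x ^+ (i' - i) = y ^+ j' * y ^- j.
    by rewrite expgnFr// -[x ^+ i'](mulVKg (y ^+ j')) -E !mulgA mulgK.
  have i0 : (0 < i' - i)%N by rewrite subn_gt0.
  case: (leqP j j') => jj.
    by have [/eqP] := xy (i' - i)%N (j' - j)%N i0; rewrite Ex expgnFr.
  have [_ /eqP] := xy (i' - i)%N (j - j')%N i0; apply.
  by rewrite Ex expgnFr 1?ltnW// invgM invgK.
exists (C1 + C2 + C3).+1 => p K L Cp CK.
have pK : (p <= K)%N by lia.
(* Translating by [x^-K] moves the edge to [x^-(K-p) k], outside [F1] since [K - p] is large. *)
have E1 : side e (x ^+ p * k) (x ^+ K * u) = side e (x ^+ p * k) (x ^+ K * o).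
  have -> : x ^+ p * k = x ^+ K * (x ^- (K - p) * k).
    by rewrite -{1}(subnKC pK) expgnDr mulgA mulgK.
  by rewrite !side_act; apply: (eq_side _ _ _ _ H1); apply: (B1 (K - p)%N) => //; lia.
have E2 : side e (x ^+ p * k) o = side e (x ^+ p * k) v.
  by apply: (eq_side _ _ _ _ H2); apply: (B2 p) => //; lia.
have E3 : side e (x ^+ p * k) v = side e (x ^+ p * k) (y ^+ L * v).
  (* The steps from [y^i v] to [y^(i+1) v] are translates of the one from [v] to [y v], so the bound
     [C3] does not depend on [L]. *)
  elim: L => [|L ->]; first by rewrite mul1g.
  rewrite expgSr -mulgA -[x ^+ p * k](mulVKg (y ^+ L)) !side_act.
  by apply: (eq_side _ _ _ _ H3); apply: (B3 p); [lia|exists L].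
rewrite E1 -E3 -E2 eq_sym; apply: axis; lia.
Qed.

End Sides.

(** * The fundamental group inside the free group on the edges *)

Section Embedding.
Variables (G : finGraph) (x0 : gvert G).
Implicit Types a b : pi1 x0.
Local Open Scope group_scope.

Definition pi1_emb a : edge_group G := eclass (sval a).
Definition cvert_emb (w : cvert x0) : edge_group G := eclass (sval w).

Lemma pi1_emb_inj : injective pi1_emb.
Proof.
move=> a b /(congr1 val); rewrite /= !reduce_id; first exact: val_inj.
  by case/andP: (svalP b).
by case/andP: (svalP a).
Qed.

Lemma cvert_emb_inj : injective cvert_emb.
Proof.
move=> a b /(congr1 val); rewrite /= !reduce_id; first exact: val_inj.
  by case/andP: (svalP b).
by case/andP: (svalP a).
Qed.

Lemma pi1_embM a b : pi1_emb (a * b) = pi1_emb a * pi1_emb b.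
Proof. by rewrite /pi1_emb -eclass_cat -[RHS]eclass_reduce. Qed.

Lemma pi1_emb1 : pi1_emb 1 = 1.
Proof. by []. Qed.

Lemma pi1_embV a : pi1_emb a^-1 = (pi1_emb a)^-1.
Proof. by rewrite /pi1_emb -eclass_inv -[RHS]eclass_reduce. Qed.

Lemma pi1_embX a n : pi1_emb (a ^+ n) = pi1_emb a ^+ n.
Proof. by elim: n => // n IH; rewrite !expgS pi1_embM IH. Qed.

Lemma cvert_emb_act a w : cvert_emb (act_vert a w) = pi1_emb a * cvert_emb w.
Proof. by rewrite /pi1_emb /cvert_emb -eclass_cat -[RHS]eclass_reduce. Qed.

Lemma pi1_emb_neq1 a : a != 1 -> pi1_emb a != 1.
Proof. by apply: contra_neq => E1; apply: pi1_emb_inj; rewrite E1 pi1_emb1. Qed.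

(* A common root in the free group on the edges need not lie in [pi1]; its power by
   the gcd of the two exponents does, by Bezout. *)
Lemma pi1_expg_eq_root a b i j : a != 1 -> b != 1 -> a ^+ i.+1 = b ^+ j.+1 ->
  exists c k l, a = c ^+ k /\ b = c ^+ l.
Proof.
move=> a1 b1 /(congr1 pi1_emb); rewrite !pi1_embX => E.
have [z [k [l [Ea Eb]]]] := expg_eq_root (pi1_emb_neq1 a1) (pi1_emb_neq1 b1) E.
have k0 : (0 < k)%N by rewrite lt0n; apply: contraTneq (pi1_emb_neq1 a1) => k0; rewrite Ea k0 eqxx.
have [i' j' Eg _] := egcdnP l k0.
exists (a ^+ i' * b ^- j'), (k %/ gcdn k l)%N, (l %/ gcdn k l)%N.
have Ez : pi1_emb (a ^+ i' * b ^- j') = z ^+ gcdn k l.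
  rewrite pi1_embM pi1_embV !pi1_embX Ea Eb -!expgnA ![(_ * i')%N]mulnC [(l * _)%N]mulnC Eg.
  by rewrite addnC expgnDr mulgK.
by split; apply: pi1_emb_inj; rewrite pi1_embX Ez -expgnA mulnC divnK ?dvdn_gcdl ?dvdn_gcdr.
Qed.

(** A trivial [a] or [b] is the zeroth power of the other. Otherwise a positive power of [a] equal
    to a power of [b] or [b^-1] gives a common root, exponent 0 being excluded by
    torsion-freeness. *)
Lemma not_powers_disjoint a b :
  ~ (exists (c : pi1 x0) (k l : int), a = zpow c k /\ b = zpow c l) ->
  forall i j, (0 < i)%N ->
    pi1_emb a ^+ i != pi1_emb b ^+ j /\ pi1_emb a ^+ i != pi1_emb b ^- j.
Proof.
move=> nab.
have a1 : a != 1.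
  by apply/eqP => a1; apply: nab; exists b, (0%:Z)%R, (1%:Z)%R.
have b1 : b != 1.
  by apply/eqP => b1; apply: nab; exists a, (1%:Z)%R, (0%:Z)%R.
have b1' : b^-1 != 1 by rewrite invg_eq1.
have nroot c i j : c != 1 -> a ^+ i.+1 = c ^+ j -> exists z k l, a = z ^+ k /\ c = z ^+ l.
  case: j => [_ /eqP|j c1]; last exact: pi1_expg_eq_root.
  rewrite expg0; move: (expg_neq1 i (pi1_emb_neq1 a1)).
  by rewrite -pi1_embX => /[swap] /eqP->; rewrite pi1_emb1 eqxx.
case=> // i j _; rewrite -!pi1_embX -pi1_embV.
split; apply/eqP => /pi1_emb_inj.
  by case/(nroot _ _ _ b1) => z [k [l [Ea Eb]]]; apply: nab; exists z, k%:Z%R, l%:Z%R.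
rewrite -expVgn => /(nroot _ _ _ b1')[z [k [l [Ea Eb]]]]; apply: nab.
exists z, k%:Z%R, (- l%:Z)%R; split=> //.
rewrite -[b]invgK Eb; case: l {Eb} => [|l] //=.
by rewrite invg1.
Qed.
End Embedding.

(** * Words in the generators theta *)

Section Words.
Variables (G : finGraph) (x0 : gvert G) (T : {set gedge G}).
Variable hT : spanning_tree x0 T.
Implicit Types (d : dart G) (s t : seq (dart G)).
Local Open Scope group_scope.

Lemma in_tree_push d s : d.1 \in T -> in_tree T s -> in_tree T (push d s).
Proof.
rewrite /in_tree; case: s => [|d' s] /= dT; first by rewrite dT.
by case: ifP => _ /=; [case/andP|rewrite dT].
Qed.

Lemma in_tree_reduce s : in_tree T s -> in_tree T (reduce s).
Proof. by elim: s => //= d s IH /andP[dT /IH]; exact: in_tree_push. Qed.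

Lemma in_tree_inv s : in_tree T (inv_walk s) = in_tree T s.
Proof. by rewrite /in_tree /inv_walk all_rev all_map. Qed.

(** The path [s^-1 t] reduces to a closed reduced path in the tree, which is empty by acyclicity. *)
Lemma tree_path_unique s t : walk x0 s -> walk x0 t -> in_tree T s -> in_tree T t ->
  wend x0 s = wend x0 t -> eclass s = eclass t.
Proof.
move=> ws wt sT tT E.
have wst : walk (wend x0 s) (inv_walk s ++ t).
  by rewrite walk_cat walk_inv// wend_inv.
have : reduce (inv_walk s ++ t) = [::].
  apply: (tree_acyclic hT (v := wend x0 s)).
  - exact: walk_reduce.
  - exact: reduced_reduce.
  - by apply: in_tree_reduce; rewrite /in_tree all_cat -!/(in_tree T _) in_tree_inv sT.
  - by rewrite wend_reduce// wend_cat wend_inv// E.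
move=> E0; have E1 : eclass (inv_walk s ++ t) = 1 by rewrite -eclass_reduce E0.
by rewrite -[RHS](mulVKg (eclass s)) -eclass_inv -(eclass_cat (inv_walk s)) E1 mulg1.
Qed.

Lemma lift_vert_in_tree v : in_tree T (sval (lift_vert hT v)).
Proof. by case/andP: (xchooseP (tree_spans hT v)). Qed.

Lemma tree_path_lift s : walk x0 s -> in_tree T s ->
  eclass s = cvert_emb (lift_vert hT (wend x0 s)).
Proof.
move=> ws sT; apply: tree_path_unique => //; first exact: cvert_walk.
  exact: lift_vert_in_tree.
by rewrite -[RHS]/(cend _) cend_lift.
Qed.

(** Coherence of the labeling, one dart at a time; chained along a path, it reads off the word of
    the path. *)
Lemma lift_vert_step d :
  (if d.1 \in T then 1 else pi1_emb (letter hT d)) * cvert_emb (lift_vert hT (dtgt d)) =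
  cvert_emb (lift_vert hT (dsrc d)) * eclass [:: d].
Proof.
have wl v : walk x0 (sval (lift_vert hT v)) := cvert_walk _.
have el v : wend x0 (sval (lift_vert hT v)) = v := cend_lift hT v.
case: ifP => dT.
  have ws : walk x0 (sval (lift_vert hT (dsrc d)) ++ [:: d]).
    by rewrite walk_cat wl el /= eqxx.
  rewrite mul1g -eclass_cat (tree_path_lift ws).
    by rewrite wend_cat.
  by rewrite /in_tree all_cat -/(in_tree T _) lift_vert_in_tree /= dT.
have Eth e : pi1_emb (theta hT e) =
    cvert_emb (lift_vert hT (gsrc e)) * eclass [:: (e, true)] *
    (cvert_emb (lift_vert hT (gtgt e)))^-1.
  by rewrite /pi1_emb /= eclass_reduce -cat1s !eclass_cat eclass_inv mulgA.
have Ed e : eclass [:: (e, false)] = (eclass [:: (e, true)])^-1.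
  by rewrite -eclass_inv.
case: d {dT} => e [] /=; first by rewrite /letter /= Eth mulgVK.
by rewrite /letter /= pi1_embV Eth !invgM invgK -!mulgA mulVg mulg1 Ed.
Qed.

Definition nontree s := [seq d <- s | d.1 \notin T].

Lemma word_value_cat s t : word_value hT (s ++ t) = word_value hT s * word_value hT t.
Proof. by rewrite /word_value big_cat. Qed.

Lemma path_word s : walk x0 s ->
  eclass s = pi1_emb (word_value hT (nontree s)) * cvert_emb (lift_vert hT (wend x0 s)).
Proof.
elim/last_ind: s => [|s d IH].
  move=> _; rewrite /word_value big_nil pi1_emb1 mul1g.
  exact: (@tree_path_lift [::]).
rewrite -cats1 walk_cat wend_cat => /andP[ws] /=; rewrite andbT => /eqP ds.
rewrite eclass_cat IH// -ds -mulgA -lift_vert_step mulgA.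
rewrite /nontree filter_cat word_value_cat pi1_embM /=.
by case: ifP => dT //=; rewrite /word_value ?big_nil ?big_seq1.
Qed.

Lemma nontree_consP s d u : nontree s = d :: u ->
  exists s1 s2, [/\ s = s1 ++ d :: s2, in_tree T s1 & d.1 \notin T].
Proof.
elim: s => //= a s IH; case: ifP => [aT [<- _]|/negbFE aT].
  by exists [::], s.
case/IH => s1 [s2 [-> s1T dT]]; exists (a :: s1), s2; split=> //=.
by rewrite /in_tree /= aT.
Qed.

(** Between two consecutive inverse letters the path would make a closed reduced excursion in the
    tree. It is empty, so these letters would already be adjacent in [s]. *)
Lemma reduced_nontree v s : walk v s -> reduced s -> reduced (nontree s).
Proof.
elim: s v => //= d s IH v /andP[_ ws] r.
have rs := reduced_cons r; case: ifP => dT; last exact: IH ws rs.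
case Es : (nontree s) (IH _ ws rs) => [|d' u] // ru.
rewrite /reduced /= -/(reduced (d' :: u)) in ru *; rewrite ru andbT.
have [s1 [s2 [E s1T _]]] := nontree_consP Es.
apply: contraTneq r => dd'; move: ws rs; rewrite E dd' walk_cat /=.
case/andP=> w1 /andP[]; rewrite dsrc_rev => /eqP e1 _ r1.
have := tree_acyclic hT w1 (reduced_catl r1) s1T (esym e1).
by move=> ->; rewrite /reduced /= eqxx.
Qed.

(** Cutting the loop at a tree edge cuts its word, and the translate of the lifted edge found there
    is the one by the initial word [g]. *)
Lemma initial_word_edge (w : pi1 x0) s1 d s2 (g := word_value hT (nontree s1)) :
  sval w = s1 ++ d :: s2 -> d.1 \in T ->
  initial_word hT g w /\
  eclass (if d.2 then s1 else rcons s1 d) =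
    pi1_emb g * cvert_emb (lift_vert hT (gsrc d.1)).
Proof.
move=> Ew dT; have /andP[ww ew] := pi1_loop w.
have rw : reduced (sval w) by case/andP: (svalP w).
have wsd : walk x0 (rcons s1 d).
  by move: ww; rewrite Ew -cat_rcons walk_cat => /andP[].
have ws1 : walk x0 s1 by move: wsd; rewrite -cats1 walk_cat => /andP[].
split.
  exists (nontree (sval w)), (nontree s1); split=> //.
  - by rewrite /is_reduced_word filter_all (reduced_nontree ww rw).
  - apply: pi1_emb_inj; rewrite /pi1_emb (path_word ww) (eqP ew).
    rewrite -[cvert_emb _]/(cvert_emb _) -(@tree_path_lift [::])//.
    by rewrite mulg1.
  - by rewrite Ew /nontree filter_cat prefix_prefix.
case: d dT wsd {Ew} => e [] /= eT wsd; rewrite path_word// /g.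
  have -> // : wend x0 s1 = gsrc e.
  by move: wsd; rewrite -cats1 walk_cat /= andbT => /andP[_ /eqP <-].
(* A reversed dart reaches the initial vertex of [e] only after [d], which adds no letter as [e] is
   in the tree. *)
have -> : wend x0 (rcons s1 (e, false)) = gsrc e by rewrite -cats1 wend_cat.
by rewrite /nontree filter_rcons /= eT.
Qed.
End Words.

(** * Crossing an edge of the universal cover *)

Section Realization.
Variables (R : realType) (D : digraph).

Lemma edge_map_continuous (e : edge D) : continuous (@edge_map R D e).
Proof. by apply/continuousP => U oU; exact: oU. Qed.

Lemma realization_continuous (X : topologicalType) (g : realization R D -> X) :
  (forall e : edge D, continuous (g \o @edge_map R D e)) -> continuous g.
Proof.
move=> cg; apply/continuousP => U oU.
suff: open_point (g @^-1` U) by [].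
move=> e; rewrite -comp_preimage.
by move/continuousP: (cg e) => /(_ U oU).
Qed.

Lemma edge_map_val (e : edge D) (t : {t : R | 0 < t < 1}) :
  edge_map e (val t) = EPoint e t.
Proof. by rewrite /edge_map valK. Qed.

Lemma edge_map0 (e : edge D) : edge_map e (0 : R) = VPoint R (src e).
Proof. by rewrite /edge_map insubF ?ltxx ?lexx. Qed.

Lemma edge_map1 (e : edge D) : edge_map e (1 : R) = VPoint R (tgt e).
Proof. by rewrite /edge_map insubF ?ltxx ?andbF// ler10. Qed.

(** Mirrors the constant extension of [edge_map] outside [0, 1]. *)
Definition clamp (t : R) : R := Num.max 0 (Num.min 1 t).

Lemma clamp_continuous : continuous clamp.
Proof.
move=> t; apply: continuous_max; first exact: cst_continuous.
by apply: continuous_min; first exact: cst_continuous.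
Qed.

Definition interpolate (h : vertex D -> R) (y : realization R D) : R :=
  match y with
  | VPoint v => h v
  | EPoint e t => (1 - val t) * h (src e) + val t * h (tgt e)
  end.

Lemma interpolate_edge_map h (e : edge D) t :
  interpolate h (edge_map e t) = (1 - clamp t) * h (src e) + clamp t * h (tgt e).
Proof.
rewrite /edge_map /clamp; case: insubP => [u /andP[t0 t1] ut |] /=.
  by rewrite ut (min_idPr (ltW t1)) (max_idPr (ltW t0)).
rewrite negb_and -!leNgt; case: (leP t 0) => [t0 _|t0 /= t1] /=.
  rewrite (min_idPr _) ?(le_trans t0)// (max_idPl _)// subr0.
  by rewrite mul1r mul0r addr0.
by rewrite (min_idPl _)// (max_idPr _)// subrr mul0r add0r mul1r.
Qed.

Lemma interpolate_continuous h : continuous (interpolate h).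
Proof.
apply: realization_continuous => e.
have -> : interpolate h \o @edge_map R D e =
    (fun t => (1 - clamp t) * h (src e) + clamp t * h (tgt e)).
  by apply/funext => t; exact: interpolate_edge_map.
move=> t; apply: cvgD; apply: cvgM; try exact: cvg_cst.
  by apply: cvgB; [exact: cvg_cst|exact: clamp_continuous].
exact: clamp_continuous.
Qed.
End Realization.

(** * Height functions on the tree and the intermediate value theorem *)

Section Crossing.
Variables (R : realType) (G : finGraph) (x0 : gvert G).
Implicit Types (a b : cedge x0) (v : cvert x0).

Definition cside a v := side (sval a).2 (cvert_emb (csrc a)) (cvert_emb v).

Lemma cvert_emb_tgt b :
  cvert_emb (ctgt b) = (cvert_emb (csrc b) * eclass [:: ((sval b).2, true)])%g.
Proof. by rewrite /cvert_emb -eclass_cat cats1 /= eclass_reduce. Qed.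

Lemma cside_edge a b : cside a (csrc b) != cside a (ctgt b) -> a = b.
Proof.
rewrite /cside cvert_emb_tgt => /side_step[/= e1 /cvert_emb_inj k1].
apply: val_inj; rewrite [LHS]surjective_pairing [RHS]surjective_pairing.
by congr pair.
Qed.

Lemma cside_src a : cside a (csrc a) = false.
Proof. by rewrite /cside /side mulVg. Qed.

Lemma cside_tgt a : cside a (ctgt a) = true.
Proof. by rewrite /cside /side cvert_emb_tgt mulKg /= eqxx. Qed.

Lemma csrc_neq_ctgt b : csrc b != ctgt b.
Proof. by apply: contraTneq (cside_tgt b) => <-; rewrite cside_src. Qed.

(* The signed distance to the initial vertex of [a], truncated beyond the two ends
   so as to be -1 or 2: its linear interpolation is in [0, 1] on [a] only. *)
Definition height a v : R :=
  if v == csrc a then 0 else if v == ctgt a then 1 else if cside a v then 2 else - 1.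

Lemma height_le0 a v : ~~ cside a v ->
  height a v <= 0 /\ (0 <= height a v -> v = csrc a).
Proof.
rewrite /height; case: eqVneq => [-> //|_].
case: eqVneq => [->|_]; first by rewrite cside_tgt.
by move/negbTE ->; split=> [|h]; [rewrite oppr_le0|move: h; rewrite oppr_ge0 ler10].
Qed.

Lemma height_ge1 a v : cside a v ->
  1 <= height a v /\ (height a v <= 1 -> v = ctgt a).
Proof.
rewrite /height; case: eqVneq => [->|_]; first by rewrite cside_src.
case: eqVneq => [-> //|_ ->]; split=> [|h]; first by rewrite ler1n.
by move: h; rewrite lern1.
Qed.

Lemma height_src a : height a (csrc a) = 0.
Proof. by rewrite /height eqxx. Qed.

Lemma height_tgt a : height a (ctgt a) = 1.
Proof. by rewrite /height eq_sym (negbTE (csrc_neq_ctgt a)) eqxx. Qed.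

(** An edge other than [a] lies on one side of [a], so its end heights are both at most 0 or both at
    least 1. A value in [0, 1] inside it would make both 0 or both 1, and its ends would
    coincide. *)
Lemma height_edge_map a (y : realization R (ucover x0)) :
  0 <= interpolate (height a : vertex (ucover x0) -> R) y <= 1 ->
  y = edge_map (a : edge (ucover x0)) (interpolate (height a : vertex (ucover x0) -> R) y).
Proof.
case: y => [v|b t]; rewrite [interpolate _ _]/= => /andP[].
  case: (boolP (cside a v)) => [/height_ge1[] _ H _ /H ->|/height_le0[] _ H /H -> _].
    by rewrite height_tgt edge_map1.
  by rewrite height_src edge_map0.
have [<-|ab] := eqVneq a b.
  by rewrite height_src height_tgt mulr0 add0r mulr1 edge_map_val.
have /andP[t0 t1] := valP t.
have /eqP sab : cside a (csrc b) == cside a (ctgt b).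
  by apply: contraNT ab => /cside_edge ->.
have conv (p q : R) : 0 <= p -> 0 <= q -> (1 - val t) * p + val t * q <= 0 ->
  p <= 0 /\ q <= 0 by move: t0 t1; move: (val t) => c c0 c1 *; split; nra.
have := csrc_neq_ctgt b; move: sab; case: (boolP (cside a (csrc b))).
  move=> /height_ge1[s1 Hs] /esym /height_ge1[g1 Hg] /eqP neq _ le1; exfalso.
  have [|||ps pt] := conv (height a (csrc b) - 1) (height a (ctgt b) - 1).
  - by rewrite subr_ge0.
  - by rewrite subr_ge0.
  - by move: le1; rewrite /=; lra.
  by rewrite subr_le0 in ps; rewrite subr_le0 in pt; apply: neq; rewrite (Hs ps) (Hg pt).
move=> /height_le0[s1 Hs] /esym /negbT/height_le0[g1 Hg] /eqP neq ge0 _; exfalso.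
have [|||ps pt] := conv (- height a (csrc b)) (- height a (ctgt b)).
- by rewrite oppr_ge0.
- by rewrite oppr_ge0.
- by move: ge0; rewrite /=; lra.
by rewrite oppr_le0 in ps; rewrite oppr_le0 in pt; apply: neq; rewrite (Hs ps) (Hg pt).
Qed.

(** The intermediate value theorem is applied to the height minus the parameter, so that a zero is a
    point whose position along [a] is [t] itself. *)
Lemma edge_crossing a (g : R -> realization R (ucover x0)) u v :
  continuous g -> g 0 = @VPoint R (ucover x0) u -> g 1 = @VPoint R (ucover x0) v -> cside a u != cside a v ->
  exists2 t, 0 <= t <= 1 & g t = edge_map (a : edge (ucover x0)) t.
Proof.
move=> cg g0 g1 uv.
pose h t := interpolate (height a : vertex (ucover x0) -> R) (g t) - t.
have ch : continuous h.
  move=> t; apply: cvgB; last exact: cvg_id.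
  by apply: continuous_comp; [exact: cg|exact: interpolate_continuous].
have [||t] := @IVT R h 0 1 0 ler01.
- exact: continuous_subspaceT.
- have -> : h 0 = height a u by rewrite /h g0 /= subr0.
  have -> : h 1 = height a v - 1 by rewrite /h g1.
  move: uv; case: (boolP (cside a u)) => [/height_ge1[u1 _]|/height_le0[u1 _]].
    rewrite eq_sym eqb_id => /height_le0[v0 _].
    by apply/andP; split; rewrite ?ge_min ?le_max; apply/orP; [right|left]; lra.
  rewrite eq_sym eqbF_neg negbK => /height_ge1[v0 _].
  by apply/andP; split; rewrite ?ge_min ?le_max; apply/orP; [left|right]; lra.
rewrite in_itv /= => t01 /eqP; rewrite subr_eq0 => /eqP ht.
by exists t => //; rewrite -{2}ht; apply: height_edge_map; rewrite ht.
Qed.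

End Crossing.

(** * Periodic points *)

Section PeriodicPoints.
Variables (R : realType) (G : finGraph) (x0 : gvert G) (T : {set gedge G}).
Variable hT : spanning_tree x0 T.
Variables (f : realization R G -> realization R G)
  (ft : realization R (ucover x0) -> realization R (ucover x0)).
Hypothesis ft_lift : is_lift f ft.
Hypothesis ft_equivariant : forall (g : pi1 x0) y, ft (deck g y) = deck g (ft y).
Implicit Types (e : gedge G) (g w : pi1 x0).

Lemma act_edge_tgt g (a : cedge x0) : ctgt (act_edge g a) = act_vert g (ctgt a).
Proof. by apply: cvert_emb_inj; rewrite cvert_emb_act !cvert_emb_tgt cvert_emb_act mulgA. Qed.

Lemma deck_edge_map g (a : edge (ucover x0)) (t : R) :
  deck g (edge_map a t) = edge_map (act_edge g a : edge (ucover x0)) t.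
Proof.
by rewrite /edge_map; case: insubP => //= _; case: ifP => //; rewrite -act_edge_tgt.
Qed.

Lemma lift_edge_tgt e : e \in T -> ctgt (lift_edge hT e) = lift_vert hT (gtgt e).
Proof.
move=> eT; apply: cvert_emb_inj; rewrite cvert_emb_tgt.
by have /= := lift_vert_step hT (e, true); rewrite eT mul1g.
Qed.

Lemma lift_point_edge_map e (t : R) : e \in T ->
  lift_point hT (edge_map (e : edge G) t) =
  edge_map (lift_edge hT e : edge (ucover x0)) t.
Proof.
move=> eT; rewrite /edge_map; case: insubP => //= _; case: ifP => //= _.
by rewrite lift_edge_tgt.
Qed.

Lemma cover_proj_lift_point (x : realization R G) : cover_proj (lift_point hT x) = x.
Proof. by case: x => //= v; rewrite cend_lift. Qed.

Lemma cover_proj_deck g y : cover_proj (deck g y) = cover_proj y :> realization R G.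
Proof. by case: y => //= v; rewrite cend_act. Qed.

Lemma cover_proj_iter N y : cover_proj (iter N ft y) = iter N f (cover_proj y).
Proof. by elim: N => //= N IH; rewrite (ft_lift.2) IH. Qed.

Lemma iter_deck N g y : iter N ft (deck g y) = deck g (iter N ft y).
Proof. by elim: N => //= N ->. Qed.

Lemma deckM g w (y : realization R (ucover x0)) : deck (g * w)%g y = deck g (deck w y).
Proof.
case: y => [v|a t] /=; first congr VPoint.
  by apply: cvert_emb_inj; rewrite !cvert_emb_act pi1_embM mulgA.
congr EPoint; apply: val_inj; congr pair.
by apply: cvert_emb_inj; rewrite !cvert_emb_act pi1_embM mulgA.
Qed.

Lemma deck1 (y : realization R (ucover x0)) : deck 1%g y = y.
Proof.
case: y => [v|a t] /=; first congr VPoint.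
  by apply: cvert_emb_inj; rewrite !cvert_emb_act pi1_emb1 mul1g.
congr EPoint; apply: val_inj; rewrite [RHS]surjective_pairing; congr pair.
by apply: cvert_emb_inj; rewrite !cvert_emb_act pi1_emb1 mul1g.
Qed.

Lemma iter_rotates k m g y : iter m ft y = deck g y ->
  iter (k * m) ft y = deck (g ^+ k)%g y.
Proof.
move=> Em; elim: k => [|k IH]; first by rewrite expg0 deck1.
by rewrite mulSn addnC iterD Em iter_deck IH -deckM -expgS.
Qed.

(** The image of the lifted edge crosses its translate by [g], at equal parameters. This is the
    rotation equation upstairs, and its projection gives the fixed point of [f^N]. *)
Lemma crossing_rotates N e g (u v : cvert x0) : (0 < N)%N -> e \in T ->
  iter N ft (@VPoint R (ucover x0) (lift_vert hT (gsrc e))) = @VPoint R (ucover x0) u ->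
  iter N ft (@VPoint R (ucover x0) (lift_vert hT (gtgt e))) = @VPoint R (ucover x0) v ->
  cside (act_edge g (lift_edge hT e)) u != cside (act_edge g (lift_edge hT e)) v ->
  exists2 x, @closed_edge R G e x & rotates hT f ft x N g.
Proof.
move=> N0 eT Eu Ev uv.
pose h t := iter N ft (edge_map (lift_edge hT e : edge (ucover x0)) t).
have cN : continuous (iter N ft).
  elim: {N0 Eu Ev h} N => [|N IH] y; first exact: cvg_id.
  by apply: continuous_comp; [exact: IH|exact: (ft_lift.1)].
have ch : continuous h.
  by move=> t; apply: continuous_comp; [exact: edge_map_continuous|exact: cN].
have [||t t01 ht] := edge_crossing ch _ _ uv.
- by rewrite /h edge_map0.
- by rewrite /h edge_map1 -Ev -lift_edge_tgt.
exists (edge_map (e : edge G) t); first by exists t; rewrite //= in_itv.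
have E : iter N ft (lift_point hT (edge_map (e : edge G) t)) =
    deck g (lift_point hT (edge_map (e : edge G) t)).
  by rewrite lift_point_edge_map// deck_edge_map -ht.
split=> //; have := congr1 (@cover_proj _ _ _) E.
by rewrite cover_proj_iter cover_proj_deck cover_proj_lift_point.
Qed.
End PeriodicPoints.

(** * Choice of the initial words and of the iterate *)

Section Branches.
Variables (G : finGraph) (x0 : gvert G) (T : {set gedge G}).
Variable hT : spanning_tree x0 T.
Implicit Types (e : gedge G) (w : pi1 x0).

(** The core of the reduced loop is one of its cyclic reductions. *)
Lemma belongs_core e w : belongs e w -> exists t c1 d c2,
  [/\ sval w = t ++ (c1 ++ d :: c2) ++ inv_walk t,
      cyclically_reduced (c1 ++ d :: c2) & d.1 = e].
Proof.
move=> ew; have rw : reduced (sval w) by case/andP: (svalP w).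
have [t [c [Ew cc]]] := cyclic_core rw.
have /mapP[d dc ed] : e \in map fst c.
  apply: ew; exists (sval w), (pi1_loop w); split=> //.
    by apply: val_inj; rewrite /= reduce_id.
  by rewrite Ew; exact: contracts_core.
by case/splitPr: dc Ew cc => c1 c2 Ew cc; exists t, c1, d, c2.
Qed.

(** The loop is cut at an occurrence of [e] in its core, which lies on the axis. [g] is fixed before
    the vertices and exponents, as one initial word must serve all rationals. *)
Lemma initial_word_separates e w1 w2 : e \in T -> belongs e w1 ->
  ~ (exists (w : pi1 x0) (k1 k2 : int), w1 = zpow w k1 /\ w2 = zpow w k2) ->
  exists2 g, initial_word hT g w1 &
    forall u v : cvert x0, exists C : nat,
      forall p K L, (C <= p)%N -> (C + p <= K)%N ->
        cside (act_edge (w1 ^+ p * g)%g (lift_edge hT e)) (act_vert (w1 ^+ K)%g u) !=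
        cside (act_edge (w1 ^+ p * g)%g (lift_edge hT e)) (act_vert (w2 ^+ L)%g v).
Proof.
move=> eT /belongs_core[t [c1 [d [c2 [Ew cc de]]]]] /not_powers_disjoint dis.
have dT : d.1 \in T by rewrite de.
have Ew' : sval w1 = (t ++ c1) ++ d :: (c2 ++ inv_walk t) by rewrite Ew -!catA.
have [ig Eg] := initial_word_edge hT Ew' dT.
exists (word_value hT (nontree T (t ++ c1))) => // u v.
have rw : reduced (sval w1) by case/andP: (svalP w1).
have Ev : val (pi1_emb w1) = t ++ (c1 ++ d :: c2) ++ inv_walk t.
  by rewrite -Ew; exact: val_eclass.
have [C HC] := axis_edge_separates (cvert_emb u) (cvert_emb v) dis
  (fun p K => axis_separates Ev cc).
exists C => p K L Cp CK; have := HC p K L Cp CK.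
by rewrite Eg mulgA -!pi1_embX -pi1_embM -!cvert_emb_act de /cside.
Qed.
End Branches.

Lemma rat_nat_fraction (r : rat) m : (0 < m)%N -> 0 < r < m%:R^-1 ->
  exists a b : nat, [/\ (0 < a)%N, (a * m < b)%N & r = a%:R / b%:R].
Proof.
move=> m0 /andP[r0 rm]; have n0 : 0 < numq r by rewrite numq_gt0.
have Er : r = `|numq r|%:R / `|denq r|%:R.
  by rewrite !pmulrn !gtz0_abs ?denq_gt0// divq_num_den.
exists `|numq r|%N, `|denq r|%N; split=> //; first by rewrite absz_gt0 gt_eqF.
rewrite -(ltr_nat rat) natrM -ltr_pdivlMr ?ltr0n//.
by rewrite mulrC -ltr_pdivrMr -?Er// ltr0n absz_gt0 denq_neq0.
Qed.

(** These are the bounds for [p = r N] and [K = N / m], with [r = a / b] and [N = b m n (C + 1)].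
    Then [K - p = (b - a m) n (C + 1)], and [a m < b]. *)
Lemma exponent_bounds C a b m n : (0 < a)%N -> (0 < m)%N -> (0 < n)%N -> (a * m < b)%N ->
  (C <= a * (m * n * C.+1))%N /\ (C + a * (m * n * C.+1) <= b * C.+1 * n)%N.
Proof.
move=> a0 m0 n0 ab.
have Cn : (C <= C.+1 * n)%N by rewrite (leq_trans (leqnSn C))// leq_pmulr.
have E : (a * (m * n * C.+1) = a * m * (C.+1 * n))%N by lia.
rewrite E; split; first by rewrite (leq_trans Cn)// leq_pmull// muln_gt0 a0.
by rewrite (leq_trans (leq_add Cn (leqnn _)))// -mulSn -mulnA leq_mul2r ab orbT.
Qed.

Theorem theorem30 (R : realType) (G : finGraph) (G_connected : connected_graph G)
  (x0 : gvert G) (T : {set gedge G}) (hT : spanning_tree x0 T)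
  (f : realization R G -> realization R G)
  (f_continuous : continuous f) (f_vertex_map : vertex_map f)
  (f_homotopic : homotopic R f id)
  (ft : realization R (ucover x0) -> realization R (ucover x0))
  (ft_lift : is_lift f ft)
  (ft_equivariant : forall (g : pi1 x0) y, ft (deck g y) = deck g (ft y))
  (e : gedge G) (e_tree : e \in T)
  (m n : nat) (w1 w2 : pi1 x0)
  (V1_rotates : rotates hT f ft (@VPoint R G (gsrc e)) m w1)
  (V2_rotates : rotates hT f ft (@VPoint R G (gtgt e)) n w2)
  (e_w1 : belongs e w1) (e_w2 : belongs e w2)
  (not_powers : ~ exists (w : pi1 x0) (k1 k2 : int),
    w1 = zpow w k1 /\ w2 = zpow w k2) :
  exists g1 g2 : pi1 x0,
    [/\ initial_word hT g1 w1, initial_word hT g2 w2 &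
      forall r s : rat,
        0 < r < (m%:R)^-1 -> 0 < s < (n%:R)^-1 ->
        exists p q p' q' : int,
          [/\ 0 < q, 0 < q', r = p%:~R / q%:~R, s = p'%:~R / q'%:~R &
            (exists2 x, @closed_edge R G e x &
               periodic_with_rotation hT f ft x ((zpow w1 p * g1)%g, q)) /\
            (exists2 x, @closed_edge R G e x &
               periodic_with_rotation hT f ft x ((zpow w2 p' * g2)%g, q'))]].
Proof.
have not_powers' : ~ exists (w : pi1 x0) (k1 k2 : int), w2 = zpow w k1 /\ w1 = zpow w k2.
  by case=> w [k1 [k2 [E2 E1]]]; apply: not_powers; exists w, k2, k1.
have [g1 ig1 sep1] := initial_word_separates hT e_tree e_w1 not_powers.
have [g2 ig2 sep2] := initial_word_separates hT e_tree e_w2 not_powers'.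
have [C1 HC1] := sep1 (lift_vert hT (gsrc e)) (lift_vert hT (gtgt e)).
have [C2 HC2] := sep2 (lift_vert hT (gtgt e)) (lift_vert hT (gsrc e)).
have [m0 _ R1] := V1_rotates; have [n0 _ R2] := V2_rotates.
exists g1, g2; split=> // r s rm sn.
have [a [b [a0 ab ->]]] := rat_nat_fraction m0 rm.
have [a' [b' [a'0 ab' ->]]] := rat_nat_fraction n0 sn.
have scale c d k : (0 < k)%N -> (0 < d)%N ->
    c%:R / d%:R = (c * k)%N%:Z%:~R / (d * k)%N%:Z%:~R :> rat.
  move=> k0 d0; rewrite -!pmulrn !natrM -mulf_div divff ?mulr1//.
  by rewrite pnatr_eq0 -lt0n.
have images k :
    iter (k * (m * n)) ft (@VPoint R (ucover x0) (lift_vert hT (gsrc e))) =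
      @VPoint R (ucover x0) (act_vert (w1 ^+ (k * n))%g (lift_vert hT (gsrc e))) /\
    iter (k * (m * n)) ft (@VPoint R (ucover x0) (lift_vert hT (gtgt e))) =
      @VPoint R (ucover x0) (act_vert (w2 ^+ (k * m))%g (lift_vert hT (gtgt e))).
  split; last by rewrite mulnA (iter_rotates ft_equivariant _ R2).
  by rewrite [(m * n)%N]mulnC mulnA (iter_rotates ft_equivariant _ R1).
(* The factor [m * n] makes the iterate a common multiple of both periods; the last factor makes the
   exponents exceed the separation bound. *)
pose k1 := (m * n * C1.+1)%N; pose k2 := (m * n * C2.+1)%N.
have k10 : (0 < k1)%N by rewrite !muln_gt0 m0 n0.
have k20 : (0 < k2)%N by rewrite !muln_gt0 m0 n0.
have b0 : (0 < b)%N by case: b ab.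
have b'0 : (0 < b')%N by case: b' ab'.
(* The fractions are left unreduced: each denominator is the number of iterations. *)
exists (a * k1)%N, (b * k1)%N, (a' * k2)%N, (b' * k2)%N.
split; [by rewrite ltz_nat muln_gt0 b0 | by rewrite ltz_nat muln_gt0 b'0 | exact: scale | exact: scale |].
split.
  have [Eu Ev] := images (b * C1.+1)%N.
  have EN : (b * C1.+1 * (m * n) = b * k1)%N by rewrite /k1; lia.
  rewrite EN in Eu Ev.
  have [Ca Cb] := exponent_bounds C1 a0 m0 n0 ab.
  have [|x xe xr] := crossing_rotates ft_lift _ e_tree Eu Ev (HC1 _ _ _ Ca Cb).
    by rewrite muln_gt0 b0.
  by exists x => //; exists (b * k1)%N, (w1 ^+ (a * k1) * g1)%g; split.
have [Eu Ev] := images (b' * C2.+1)%N.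
have EN : (b' * C2.+1 * (m * n) = b' * k2)%N by rewrite /k2; lia.
rewrite EN in Eu Ev.
have [Ca Cb] := exponent_bounds C2 a'0 n0 m0 ab'.
(* The roles of the two ends are exchanged: [w1] now carries the free exponent [L = N / m], and the
   separated vertices come in the opposite order. *)
have := HC2 _ _ (b' * C2.+1 * n)%N Ca Cb; rewrite eq_sym [(n * m)%N]mulnC => sep.
have [|x xe xr] := crossing_rotates ft_lift _ e_tree Eu Ev sep.
  by rewrite muln_gt0 b'0.
by exists x => //; exists (b' * k2)%N, (w2 ^+ (a' * k2) * g2)%g; split.
Qed.
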